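(* Let $f:\mathbb R^n\to\mathbb R$ be a multilinear function in $n$ variables with $N$ non-zero monomial terms. Then for any $r,s\in\mathbb R^n$ and each $i\in\{1,\dots,n\}$, the Aumann-Shapley-Shubik attribution $z_i(r,s,f)$ is computable (given $r$, $s$, $i$ and the list of non-zero monomial terms of $f$ with their coefficients as input) in $O(n^2\cdot N)$ time and $O(n)$ memory.
   Context: A function $f:\mathbb R^n\to\mathbb R$ is multilinear if $f(x)=\sum_{I\subseteq\{1,\dots,n\}} c_I\prod_{i\in I}x_i$ for some real constants $c_I$; its non-zero monomial terms are those with $c_I\ne0$. The Aumann-Shapley-Shubik attribution of a multilinear function $f$ is the common value of the Aumann-Shapley attribution $(s_i-r_i)\int_0^1\partial_i f(r+t(s-r))\,dt$ and the Shapley-Shubik attribution $\frac1{n!}\sum_{\sigma\in S_n}\big[f(u^{\{j:\sigma(j)\le\sigma(i)\}})-f(u^{\{j:\sigma(j)<\sigma(i)\}})\big]$, where for $I\subseteq\{1,\dots,n\}$ the point $u^I\in\mathbb R^n$ has coordinates $u^I_j=s_j$ for $j\in I$ and $u^I_j=r_j$ for $j\notin I$; these two coincide for multilinear $f$. Time counts arithmetic operations ($+,-,\times,\div$) on real numbers, each at unit cost, and memory counts the number of stored real numbers in working memory (the read-only input listing the monomials of $f$ is not counted). *)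

(* Defs.v *)
From HB Require Import structures.
From mathcomp Require Import all_boot all_order all_algebra all_fingroup.
From mathcomp Require Import all_classical all_reals all_analysis.
Set Implicit Arguments.
Unset Strict Implicit.
Unset Printing Implicit Defensive.
Import Order.TTheory GRing.Theory Num.Theory.
Import numFieldNormedType.Exports.
Local Open Scope ring_scope.

(* Players are indexed from 0. *)

Section Attribution.
Context {R : realType} {n : nat}.
Implicit Types (f : 'rV[R]_n -> R) (c : {set 'I_n} -> R) (r s : 'rV[R]_n).

Definition multilinear_with c f : Prop :=
  forall x : 'rV[R]_n, f x = \sum_(A : {set 'I_n}) c A * \prod_(i in A) x ord0 i.

Definition nonzero_terms c : seq ({set 'I_n} * R) :=
  [seq (A, c A) | A <- enum {set 'I_n} & c A != 0].

Definition partial f (i : 'I_n) (x : 'rV[R]_n) : R := 'D_(delta_mx ord0 i) f x.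

Definition aumann_shapley r s f (i : 'I_n) : R :=
  (s ord0 i - r ord0 i) *
  \int[lebesgue_measure]_(t in `[0, 1]%classic) partial f i (r + t *: (s - r)).

Definition switch_point r s (A : {set 'I_n}) : 'rV[R]_n :=
  \row_j (if j \in A then s ord0 j else r ord0 j).

Definition shapley_shubik r s f (i : 'I_n) : R :=
  (n`!%:R)^-1 * \sum_(p : 'S_n)
    (f (switch_point r s [set j | (p j <= p i)%N]%SET) -
     f (switch_point r s [set j | (p j < p i)%N]%SET)).

Definition aumann_shapley_shubik r s f (i : 'I_n) (z : R) : Prop :=
  z = aumann_shapley r s f i /\ z = shapley_shubik r s f i.

End Attribution.

(* A real random-access machine, as a while language.

   A program is a fixed piece of syntax, the same for all inputs.  Its working
   memory is an array of M cells, each holding one real, addressed indirectly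
   through natural-number expressions; a program that leaves the range
   0, ..., M-1 is stuck.  Control uses finitely many named natural-number
   variables.  The only arithmetic on reals is [Arith], which costs one unit of
   time; moving a real, loading an integer literal and handling control are not
   arithmetic operations on reals and cost nothing.  Nothing converts between
   reals and naturals, so no real arithmetic can be done in the control part. *)

Inductive iexpr :=
  | ILit of nat
  | IVar of nat
  | INvars                       (* n *)
  | INterms                      (* N, the length of the list of monomials *)
  | ITarget                      (* i *)
  | IAdd of iexpr & iexpr
  | ISub of iexpr & iexpr.       (* truncated subtraction *)

Inductive test :=
  | TLe of iexpr & iexpr
  | TOccurs of iexpr & iexpr     (* [TOccurs k j]: x_j divides the k-th monomial *)
  | TNot of test
  | TAnd of test & test.

Inductive arith_op := OpAdd | OpSub | OpMul | OpDiv.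

Inductive cmd :=
  | Skip
  | Seq of cmd & cmd
  | If of test & cmd & cmd
  | While of test & cmd
  | SetVar of nat & iexpr
  | LoadLit of iexpr & int                         (* cell a := literal *)
  | LoadCoef of iexpr & iexpr                      (* cell a := k-th coefficient *)
  | Move of iexpr & iexpr                          (* cell a := cell b *)
  | Arith of arith_op & iexpr & iexpr & iexpr.     (* cell a := cell b op cell d *)

Record state (R : Type) := State { ivar : nat -> nat; cell : nat -> R }.

Section Semantics.
Context {R : realType} {n : nat}.

(* The read-only input: the list of monomials with their coefficients, and the
   index of the player whose attribution is requested. *)
Variables (terms : seq ({set 'I_n} * R)) (i : 'I_n).
(* The number of cells of working memory. *)
Variable M : nat.

Definition term_at (k : nat) : {set 'I_n} * R := nth (finset.set0, 0) terms k.

Fixpoint ieval (v : nat -> nat) (e : iexpr) : nat :=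
  match e with
  | ILit m => m
  | IVar x => v x
  | INvars => n
  | INterms => size terms
  | ITarget => i
  | IAdd e1 e2 => (ieval v e1 + ieval v e2)%N
  | ISub e1 e2 => (ieval v e1 - ieval v e2)%N
  end.

Fixpoint teval (v : nat -> nat) (b : test) : bool :=
  match b with
  | TLe e1 e2 => (ieval v e1 <= ieval v e2)%N
  | TOccurs k j => [exists p in (term_at (ieval v k)).1, val p == ieval v j]
  | TNot b1 => ~~ teval v b1
  | TAnd b1 b2 => teval v b1 && teval v b2
  end.

Definition aeval (o : arith_op) (x y : R) : R :=
  match o with
  | OpAdd => x + y
  | OpSub => x - y
  | OpMul => x * y
  | OpDiv => x / y
  end.

Definition set_ivar (st : state R) (x m : nat) : state R :=
  State [eta ivar st with x |-> m] (cell st).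

Definition set_cell (st : state R) (a : nat) (y : R) : state R :=
  State (ivar st) [eta cell st with a |-> y].

(* [exec p st st' t]: run from st, p terminates in st' after t arithmetic
   operations.  Division by zero is stuck. *)
Inductive exec : cmd -> state R -> state R -> nat -> Prop :=
  | ExecSkip st : exec Skip st st 0
  | ExecSeq p q st st1 st2 t1 t2 :
      exec p st st1 t1 -> exec q st1 st2 t2 -> exec (Seq p q) st st2 (t1 + t2)
  | ExecIfTrue b p q st st' t :
      teval (ivar st) b -> exec p st st' t -> exec (If b p q) st st' t
  | ExecIfFalse b p q st st' t :
      ~~ teval (ivar st) b -> exec q st st' t -> exec (If b p q) st st' t
  | ExecWhileTrue b p st st1 st2 t1 t2 :
      teval (ivar st) b -> exec p st st1 t1 -> exec (While b p) st1 st2 t2 ->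
      exec (While b p) st st2 (t1 + t2)
  | ExecWhileFalse b p st : ~~ teval (ivar st) b -> exec (While b p) st st 0
  | ExecSetVar x e st :
      exec (SetVar x e) st (set_ivar st x (ieval (ivar st) e)) 0
  | ExecLoadLit a (m : int) st :
      (ieval (ivar st) a < M)%N ->
      exec (LoadLit a m) st (set_cell st (ieval (ivar st) a) m%:~R) 0
  | ExecLoadCoef a k st :
      (ieval (ivar st) a < M)%N -> (ieval (ivar st) k < size terms)%N ->
      exec (LoadCoef a k) st
        (set_cell st (ieval (ivar st) a) (term_at (ieval (ivar st) k)).2) 0
  | ExecMove a b st :
      (ieval (ivar st) a < M)%N -> (ieval (ivar st) b < M)%N ->
      exec (Move a b) st
        (set_cell st (ieval (ivar st) a) (cell st (ieval (ivar st) b))) 0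
  | ExecArith o a b d st :
      (ieval (ivar st) a < M)%N -> (ieval (ivar st) b < M)%N ->
      (ieval (ivar st) d < M)%N ->
      (o = OpDiv -> cell st (ieval (ivar st) d) != 0) ->
      exec (Arith o a b d) st
        (set_cell st (ieval (ivar st) a)
           (aeval o (cell st (ieval (ivar st) b)) (cell st (ieval (ivar st) d))))
        1.

(* Working memory starts with r in cells 0, ..., n-1 and s in cells
   n, ..., 2n-1, so r and s count towards memory; everything else, control
   variables included, is uninitialized. *)
Definition initial (r s : 'rV[R]_n) (st : state R) : Prop :=
  forall j : 'I_n, cell st j = r ord0 j /\ cell st (n + j)%N = s ord0 j.

End Semantics.

(* Given r, s, i and the list of monomials, p halts with z in cell 0, using at
   most T arithmetic operations and at most M cells. *)
Definition computes_within {R : realType} {n : nat} (p : cmd)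
    (terms : seq ({set 'I_n} * R)) (r s : 'rV[R]_n) (i : 'I_n)
    (z : R) (T M : nat) : Prop :=
  (2 * n <= M)%N /\
  forall st : state R, initial r s st ->
  exists st' t,
    [/\ exec terms i M p st st' t, (t <= T)%N & cell st' 0 = z].

(* Main.v *)
Require Import Defs.
From mathcomp Require Import all_boot all_order all_algebra all_fingroup.
From mathcomp Require Import all_classical all_reals all_analysis.
From mathcomp Require Import zify ring.
Set Implicit Arguments.
Unset Strict Implicit.
Unset Printing Implicit Defensive.
Import Order.TTheory GRing.Theory Num.Theory.
Import numFieldNormedType.Exports.
Local Open Scope ring_scope.

(* Along the segment from r to s the partial derivative of a monomial
   c_A prod_(j in A) x_j is the polynomial c_A prod_(j in A, j != i) (r_j + (s_j - r_j) t)
   in t.  Expanding each factor as (1 - t) r_j + t s_j and integrating with the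
   beta integral int t^k (1 - t)^(n-1-k) = k! (n-1-k)! / n! gives the probability
   that a given set of k players precedes i in a random order, so the integral is
   also the Shapley-Shubik average.  Multiplying the factors one at a time costs
   O(n) operations per factor, hence O(n^2) per monomial, and the coefficients
   and their integral fit in O(n) cells. *)

(** * Integration of polynomials over the unit interval *)

(** Integral over [0, 1] taken coefficientwise: linearity and the beta integral become pure algebra,
    and measure theory enters only in [Rintegral_horner]. *)
Definition poly_int {R : unitRingType} (p : {poly R}) : R :=
  \sum_(k < size p) p`_k / k.+1%:R.

Section PolyInt.
Context {R : realType}.
Implicit Types p q : {poly R}.

Lemma poly_int_widen m p :
  (size p <= m)%N -> poly_int p = \sum_(k < m) p`_k / k.+1%:R.
Proof.
move=> pm; rewrite /poly_int (big_ord_widen _ (fun k => p`_k / k.+1%:R) pm) big_mkcond.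
by apply: eq_bigr => k _; case: ltnP => // pk; rewrite nth_default ?mul0r.
Qed.

Lemma poly_intD p q : poly_int (p + q) = poly_int p + poly_int q.
Proof.
pose m := maxn (size p) (size q).
rewrite !(@poly_int_widen m) ?leq_maxl ?leq_maxr ?size_polyD // -big_split /=.
by apply: eq_bigr => k _; rewrite coefD mulrDl.
Qed.

Lemma poly_intZ a p : poly_int (a *: p) = a * poly_int p.
Proof.
rewrite !(@poly_int_widen (size p)) ?size_scale_leq // mulr_sumr.
by apply: eq_bigr => k _; rewrite coefZ mulrA.
Qed.

Lemma poly_int_sum (I : Type) (l : seq I) (P : pred I) (F : I -> {poly R}) :
  poly_int (\sum_(x <- l | P x) F x) = \sum_(x <- l | P x) poly_int (F x).
Proof.
apply: (big_morph (@poly_int R) poly_intD).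
by rewrite /poly_int size_poly0 big_ord0.
Qed.

Lemma poly_int_deriv p : poly_int p^`() = p.[1] - p.[0].
Proof.
rewrite (@poly_int_widen (size p).-1); last exact: size_poly.
rewrite horner_coef0 horner_coef.
have [->|] := eqVneq p 0.
  by rewrite size_poly0 !big_ord0 coef0 subr0.
rewrite -size_poly_gt0; case: (size p) => // m _ /=.
rewrite big_ord_recl expr0 mulr1 [RHS]addrC addKr; apply: eq_bigr => k _.
by rewrite coef_deriv expr1n mulr1 lift0 -(mulr_natr p`_k.+1) mulfK // pnatr_eq0.
Qed.

(** Integration by parts, by induction on [m]: X^(k+1) (1 - X)^(m+1) vanishes at 0 and 1, so its
    derivative integrates to 0, which trades a power of 1 - X for a power of X. *)
Lemma poly_int_beta k m :
  poly_int ('X^k * (1 - 'X) ^+ m : {poly R}) = (k`! * m`!)%:R / (k + m).+1`!%:R.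
Proof.
elim: m k => [|m IH] k.
  rewrite expr0 mulr1 addn0 fact0 muln1 factS natrM invfM mulrCA mulfV ?mulr1; last first.
    by rewrite pnatr_eq0 -lt0n fact_gt0.
  rewrite /poly_int size_polyXn big_ord_recr /= big1 ?add0r => [|l _].
    by rewrite coefXn eqxx mul1r.
  by rewrite coefXn ltn_eqF // mul0r.
have k0 : k.+1%:R != 0 :> R by rewrite pnatr_eq0.
have dE : ('X^(k.+1) * (1 - 'X) ^+ m.+1)^`() =
    k.+1%:R *: ('X^k * (1 - 'X) ^+ m.+1) - m.+1%:R *: ('X^(k.+1) * (1 - 'X) ^+ m) :> {poly R}.
  rewrite derivM derivXn deriv_exp derivB derivX derivC /= sub0r -!mul_polyC !polyC_natr.
  set D := 1 - 'X; rewrite exprS -mulr_natr -[in X in _ + X]mulr_natr.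
  by move: ('X^k) ('X^(k.+1)) (D ^+ m) => a b c; ring.
have ends : ('X^(k.+1) * (1 - 'X) ^+ m.+1 : {poly R}).[1] -
    ('X^(k.+1) * (1 - 'X) ^+ m.+1 : {poly R}).[0] = 0.
  by rewrite !hornerE subrr !expr0n /= mulr0 mul0r subrr.
have := poly_int_deriv ('X^(k.+1) * (1 - 'X) ^+ m.+1).
rewrite ends dE -scaleNr poly_intD !poly_intZ IH mulNr addnS addSn.
move=> /eqP; rewrite subr_eq0 => /eqP eq0.
apply: (mulfI k0); rewrite eq0 !mulrA -!natrM; congr (_%:R / _).
rewrite !factS; nia.
Qed.

Lemma Rintegral_horner p :
  \int[lebesgue_measure]_(t in `[0, 1]%classic) p.[t] = poly_int p.
Proof.
(* An antiderivative of [p]; at k = 0 the division by zero returns 0, so the constant term is 0. *)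
pose F : {poly R} := \poly_(k < (size p).+1) (p`_k.-1 / k%:R).
have dF : F^`() = p.
  apply/polyP => k; rewrite coef_deriv coef_poly /= ltnS.
  case: ltnP => [_|pk]; last by rewrite mul0rn nth_default.
  by rewrite -(mulr_natr (_ / _)) mulfVK // pnatr_eq0.
rewrite -dF poly_int_deriv dF /Rintegral (@continuous_FTC2 _ _ (horner F) 0 1) //.
- exact: continuous_subspaceT (@continuous_horner _ _).
- split.
  + by move=> x _; exact: derivable_horner.
  + by apply: cvg_at_right_filter; exact: continuous_horner.
  + by apply: cvg_at_left_filter; exact: continuous_horner.
- by move=> x _; rewrite derive1E derive_val dF.
Qed.

(** Each factor raises the degree by at most one. This later shows that [n] coefficients suffice for
    the path polynomial. *)
Lemma size_prod_affine (I : Type) (u : seq I) (P : pred I) (a b : I -> R) :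
  (size (\prod_(j <- u | P j) ((a j)%:P + b j *: 'X))%R <= (count P u).+1)%N.
Proof.
elim: u => [|j u IH]; first by rewrite big_nil size_poly1.
rewrite big_cons /=; case: (P j) => //=.
apply: leq_trans (size_polyMleq _ _) _.
have : (size ((a j)%:P + b j *: 'X)%R <= 2)%N.
  apply: leq_trans (size_polyD _ _) _; rewrite geq_max.
  by rewrite (leq_trans (size_polyC_leq1 _)) // (leq_trans (size_scale_leq _ _)) // size_polyX.
by move=> /leq_add/(_ IH); rewrite add1n; case: (_ + _)%N.
Qed.

End PolyInt.

(** * Predecessor sets in a random order *)

Section Counting.
Variable n : nat.
Implicit Types (p : 'S_n) (S T : {set 'I_n}) (i : 'I_n).

Definition predecessors p i : {set 'I_n} := [set j | (p j < p i)%N]%SET.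

(** The predecessors are the preimage, under a bijection, of the positions below [p i]. *)
Lemma card_predecessors p i : #|predecessors p i| = p i.
Proof.
have -> : predecessors p i = p @^-1: [set k : 'I_n | (k < p i)%N]%SET.
  by apply/setP => j; rewrite !inE.
rewrite card_preimset; last exact: perm_inj.
rewrite -sum1dep_card (big_ord_narrow (ltnW (ltn_ord (p i)))) /=.
by rewrite sum_nat_const card_ord muln1.
Qed.

Lemma notin_predecessors p i : i \notin predecessors p i.
Proof. by rewrite inE ltnn. Qed.

Lemma predecessors_perm (q p : 'S_n) i j :
  (j \in predecessors (q * p) i) = (q j \in predecessors p (q i)).
Proof. by rewrite !inE !permM. Qed.

(** List each set first, then [i], then the remaining players, and match the two lists position by
    position; equal cardinals put [i] at the same position in both. *)
Lemma perm_card_eq S T i : i \notin S -> i \notin T -> #|S| = #|T| ->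
  exists q : 'S_n, q i = i /\ forall j, (q j \in T) = (j \in S).
Proof.
move=> iS iT ST.
pose l (U : {set 'I_n}) := enum U ++ i :: enum (~: (i |: U)).
have lP (U : {set 'I_n}) : i \notin U -> perm_eq (l U) (enum 'I_n).
  move=> iU; apply: uniq_perm; rewrite ?enum_uniq //.
    rewrite cat_uniq /= !enum_uniq /= !mem_enum !inE eqxx /= (negbTE iU) /= andbT.
    by apply/hasPn => j; rewrite !mem_enum !inE negb_or => /andP[_].
  by move=> j; rewrite mem_cat in_cons !mem_enum !inE; case: (j \in U); case: (j == i).
have uT : uniq (l T) by rewrite (perm_uniq (lP _ iT)) enum_uniq.
have memS j : j \in l S by rewrite (perm_mem (lP _ iS)) mem_enum.
have sz : size (l S) = size (l T) by rewrite (perm_size (lP _ iS)) (perm_size (lP _ iT)).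
(* The default [i] is never returned by overflow, since the index is always in range. *)
pose g j := nth i (l T) (index j (l S)).
have ilt j : (index j (l S) < size (l T))%N by rewrite -sz index_mem.
have g_inj : injective g.
  move=> j j' /eqP; rewrite nth_uniq // => /eqP e.
  by rewrite -(nth_index i (memS j)) e nth_index.
have gE j : perm g_inj j = g j by rewrite permE.
exists (perm g_inj); split=> [|j].
  rewrite gE /g /l index_cat mem_enum (negbTE iS) /= eqxx addn0.
  by rewrite -cardE ST cardE nth_cat ltnn subnn.
rewrite gE /g; apply/idP/idP => [gT|jS].
- rewrite -mem_enum -(nth_index i (memS j)).
  (* Past the initial segment, [l T] contains only [i] and players outside [T]. *)
  have : (index j (l S) < size (enum T))%N.
    apply: contraLR gT; rewrite -leqNgt => le; rewrite {1}/l nth_cat ltnNge le /=.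
    have /(mem_nth i) : (index j (l S) - size (enum T) < size (i :: enum (~: (i |: T))))%N.
      have szT : size (l T) = (size (enum T) + size (i :: enum (~: (i |: T))))%N.
        by rewrite size_cat.
      have := ilt j; rewrite szT.
      by move: (size _) (size _) (index _ _) le => *; lia.
    rewrite in_cons mem_enum !inE negb_or => /orP[/eqP ->//|/andP[]//].
  by rewrite -cardE -ST cardE {2}/l nth_cat => lt; rewrite lt mem_nth.
- rewrite /l index_cat mem_enum jS nth_cat -cardE -ST cardE index_mem mem_enum jS.
  by rewrite -mem_enum mem_nth // -cardE -ST cardE index_mem mem_enum.
Qed.

Definition predecessor_count i S : nat := #|[set p : 'S_n | predecessors p i == S]%SET|.

(** Relabelling the players by a permutation that fixes [i] and carries [T] onto [S] is a bijection
    between the two sets of orders. *)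
Lemma predecessor_count_eq i S T : i \notin S -> i \notin T -> #|S| = #|T| ->
  predecessor_count i S = predecessor_count i T.
Proof.
move=> iS iT ST; have [q [qi qTS]] := perm_card_eq iT iS (esym ST).
rewrite /predecessor_count -(card_imset _ (mulgI q)); apply: eq_card => p.
have predE (p' : 'S_n) j : (j \in predecessors (q * p') i) = (q j \in predecessors p' i).
  by rewrite predecessors_perm qi.
rewrite [RHS]inE; apply/imsetP/eqP => [[p' + ->]|pT].
  by rewrite inE => /eqP pS; apply/setP => j; rewrite predE pS qTS.
exists (q^-1 * p)%g; last by rewrite mulKVg.
rewrite inE; apply/eqP/setP => j.
by rewrite -[j](permKV q) -predE mulKVg pT qTS.
Qed.

(** Composing with a transposition of two positions identifies any two fibres, so the n! orders
    split into n equal classes. *)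
Lemma perm_fiber_card i k : #|[set p : 'S_n | p i == k]%SET| = n.-1`!.
Proof.
have fiberE l : #|[set p : 'S_n | p i == l]%SET| = #|[set p : 'S_n | p i == k]%SET|.
  rewrite -(card_imset _ (mulIg (tperm l k))); apply: eq_card => p.
  rewrite [RHS]inE; apply/imsetP/eqP => [[p' + ->]|pk].
    by rewrite inE permM => /eqP ->; rewrite tpermL.
  exists (p * tperm l k)%g; first by rewrite inE permM pk tpermR.
  by rewrite -mulgA tperm2 mulg1.
have : (n * #|[set p : 'S_n | p i == k]%SET| = n`!)%N.
  rewrite -card_Sn -[RHS]sum1_card (partition_big (fun p : 'S_n => p i) xpredT) //=.
  rewrite (eq_bigr (fun=> #|[set p : 'S_n | p i == k]%SET|)) => [|l _].
    by rewrite sum_nat_const card_ord.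
  by rewrite -(fiberE l) -sum1dep_card; apply: eq_bigl => p; rewrite ?inE.
have n_gt0 : (0 < n)%N by exact: leq_trans (ltn_ord i).
have factE : n`! = (n * n.-1`!)%N by rewrite -[in LHS](prednK n_gt0) factS prednK.
by rewrite factE => /eqP; rewrite eqn_pmul2l // => /eqP.
Qed.

(** The (n-1)! orders with [i] at position #|S| are shared equally among the 'C(n-1, #|S|) sets of
    that size avoiding [i]. *)
Lemma predecessor_countE i S : i \notin S ->
  predecessor_count i S = ((#|S|)`! * (n.-1 - #|S|)`!)%N.
Proof.
move=> iS.
have Sn : (#|S| < n)%N.
  rewrite -[X in (_ < X)%N]card_ord -[X in (_ < X)%N]cardsT; apply: proper_card.
  by rewrite properT; apply: contraNneq iS => ->; rewrite inE.
have : ('C(n.-1, #|S|) * predecessor_count i S = n.-1`!)%N.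
  rewrite -(perm_fiber_card i (Ordinal Sn)) -sum1dep_card.
  rewrite (partition_big (predecessors^~ i)
     (fun T => (T \subset ~: [set i]) && (#|T| == #|S|))) /=; last first.
    move=> p /eqP pi; rewrite card_predecessors pi eqxx andbT.
    by rewrite finset.subsetC finset.sub1set inE notin_predecessors.
  have -> : n.-1 = #|(~: [set i])%SET| by rewrite cardsC1 card_ord.
  rewrite -cards_draws -sum_nat_const big_mkcond [RHS]big_mkcond /=.
  apply: eq_bigr => T _; rewrite inE; case: ifP => // /andP[].
  rewrite finset.subsetC finset.sub1set inE => iT /eqP TS.
  rewrite (predecessor_count_eq iS iT) // sum1dep_card; apply: eq_card => p.
  rewrite !inE; apply/idP/idP => [pT|/andP[]//]; rewrite pT andbT.
  by apply/eqP/val_inj; rewrite /= -card_predecessors (eqP pT).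
move=> e; have Sn' : (#|S| <= n.-1)%N by lia.
have := bin_fact Sn'; rewrite -e => /eqP; rewrite eqn_pmul2l ?bin_gt0 //.
by move=> /eqP.
Qed.

End Counting.

(** * Closed form of the attribution *)

Section Attributions.
Context {R : realType} {n : nat}.
Implicit Types (c : {set 'I_n} -> R) (f : 'rV[R]_n -> R) (r s x : 'rV[R]_n).

(** The formal partial derivative. It does not depend on x_i, so it is also the exact slope of any
    finite change of that coordinate. *)
Definition mpartial c (i : 'I_n) x : R :=
  \sum_(A : {set 'I_n} | i \in A) c A * \prod_(j in A | j != i) x ord0 j.

(** Monomials without x_i cancel, and the others are linear in x_i. This serves both the difference
    quotient and the Shapley-Shubik increments. *)
Lemma multilinear_diff c f (i : 'I_n) x (y : 'rV[R]_n) :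
  multilinear_with c f -> (forall j, j != i -> x ord0 j = y ord0 j) ->
  f x - f y = (x ord0 i - y ord0 i) * mpartial c i x.
Proof.
move=> fE xy; rewrite !fE -sumrB (bigID (fun A : {set 'I_n} => i \in A)) /=.
rewrite [X in _ + X]big1 ?addr0; last first.
  move=> A iA; rewrite (eq_bigr (fun j => y ord0 j)) ?subrr // => j jA.
  by apply: xy; apply: contraNneq iA => <-.
rewrite /mpartial mulr_sumr; apply: eq_bigr => A iA.
rewrite (bigD1 i iA) /= [X in _ - _ * X](bigD1 i iA) /=.
rewrite [X in _ - _ * (_ * X)](eq_bigr (fun j => x ord0 j)); first by ring.
by move=> j /andP[_ /xy].
Qed.

Lemma partial_multilinear c f (i : 'I_n) x :
  multilinear_with c f -> partial f i x = mpartial c i x.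
Proof.
move=> fE; rewrite /partial /derive; apply: cvg_lim => //.
(* The difference quotient is constant for nonzero [h], so no limit has to be estimated. *)
apply: cvg_near_cst; near=> h.
have h0 : h != 0 by near: h; exact: nbhs_dnbhs_neq.
rewrite /= (multilinear_diff (i := i) fE) => [|j ji]; last first.
  by rewrite !mxE (negbTE ji) andbF mulr0 add0r.
rewrite !mxE !eqxx mulr1 addrK /mpartial scalerA mulVf // scale1r.
apply: eq_bigr => A _; congr (_ * _); apply: eq_bigr => j /andP[_ ji].
by rewrite !mxE (negbTE ji) andbF mulr0 add0r.
Unshelve. all: by end_near.
Qed.

Definition path_poly r s (i : 'I_n) (A : {set 'I_n}) : {poly R} :=
  \prod_(j in A | j != i) ((r ord0 j)%:P + (s ord0 j - r ord0 j) *: 'X).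

(** The closed form to which both attributions and the output of the program are compared. *)
Definition attribution c r s (i : 'I_n) : R :=
  (s ord0 i - r ord0 i) *
  \sum_(A : {set 'I_n} | i \in A) c A * poly_int (path_poly r s i A).

Lemma aumann_shapleyE c f r s (i : 'I_n) :
  multilinear_with c f -> aumann_shapley r s f i = attribution c r s i.
Proof.
move=> fE; rewrite /aumann_shapley /attribution; congr (_ * _).
pose P : {poly R} := \sum_(A : {set 'I_n} | i \in A) c A *: path_poly r s i A.
transitivity (poly_int P); last first.
  by rewrite poly_int_sum; apply: eq_bigr => A _; rewrite poly_intZ.
rewrite -Rintegral_horner; apply: eq_Rintegral => t _.
rewrite (partial_multilinear _ _ fE) /P horner_sum; apply: eq_bigr => A _.
rewrite hornerZ horner_prod; congr (_ * _); apply: eq_bigr => j _.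
by rewrite !mxE !hornerE mulrC.
Qed.

(** Factors outside [J] are padded as 1 = X + (1 - X). Every product of choices then has n-1 factors
    X or 1 - X, and its powers depend on #|S| alone, not on [J]. *)
Lemma prod_affine_bernstein (J : {set 'I_n}) (a b : 'I_n -> R) (i : 'I_n) :
  \prod_(j in J | j != i) ((a j)%:P + (b j - a j) *: 'X) =
  \sum_(S : {set 'I_n} | i \notin S)
    (\prod_(j in J | j != i) (if j \in S then b j else a j)) *:
      ('X^#|S| * (1 - 'X) ^+ (n.-1 - #|S|)) :> {poly R}.
Proof.
pose w (z : 'I_n -> R) j := if j \in J then z j else 1.
(* At [i] the two summands are 0 and 1, which kills every [S] containing [i]. *)
pose F j : {poly R} := if j == i then 0 else w b j *: 'X.
pose G j : {poly R} := if j == i then 1 else w a j *: (1 - 'X).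
transitivity (\prod_j (F j + G j)).
  rewrite big_mkcond /=; apply: eq_bigr => j _; rewrite /F /G /w.
  have [->|ji] := eqVneq j i; first by rewrite andbF add0r.
  rewrite andbT; case: ifP => _; last by rewrite !scale1r addrC subrK.
  by rewrite scalerBl scalerBr alg_polyC addrCA.
rewrite bigA_distr (bigID (fun S : {set 'I_n} => i \in S)) /= big1 ?add0r => [|S iS]; last first.
  by rewrite (bigD1 i) //= iS /F eqxx mul0r.
apply: eq_bigr => S iS; rewrite (bigD1 i) //= (negbTE iS) {1}/G eqxx mul1r.
transitivity (\prod_(j | j != i) ((if j \in J then if j \in S then b j else a j else 1) *:
    (if j \in S then 'X else 1 - 'X : {poly R}))).
  apply: eq_bigr => j ji; rewrite /F /G /w (negbTE ji).
  by case: (j \in S); case: (j \in J).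
rewrite scaler_prod; congr (_ *: _).
  by rewrite [RHS]big_mkcondl.
rewrite (bigID (fun j => j \in S)) /=.
rewrite (eq_bigr (fun=> 'X)) => [|j /andP[_ ->] //].
rewrite [X in _ * X](eq_bigr (fun=> 1 - 'X)) => [|j /andP[_ /negbTE ->] //].
have cardS : #|[predI predC1 i & S]| = #|S|.
  by apply: eq_card => j; rewrite !inE; case: eqVneq => // ->; rewrite (negbTE iS).
have cardDS : #|[predD predC1 i & S]| = (n.-1 - #|S|)%N.
  by rewrite -[n in n.-1](card_ord n) -(cardC1 i) -(cardID S (predC1 i)) cardS addKn.
rewrite !prodr_const; congr (_ ^+ _ * _ ^+ _).
  by rewrite -cardS; apply: eq_card => j; rewrite !unfold_in.
by rewrite -cardDS; apply: eq_card => j; rewrite !unfold_in /= andbC.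
Qed.

(** Grouping the orders by predecessor set gives [S] the weight #|S|! (n-1-#|S|)! / n!, a beta
    integral; the Bernstein expansion of the path polynomial produces the same weights. *)
Lemma shapley_shubikE c f r s (i : 'I_n) :
  multilinear_with c f -> shapley_shubik r s f i = attribution c r s i.
Proof.
move=> fE; have n_gt0 : (0 < n)%N by exact: leq_trans (ltn_ord i).
pose G S := mpartial c i (switch_point r s S).
have stepE (p : 'S_n) : f (switch_point r s [set j | (p j <= p i)%N]%SET) -
     f (switch_point r s [set j | (p j < p i)%N]%SET) =
     (s ord0 i - r ord0 i) * G (predecessors p i).
  (* The sign is flipped so that the slope is taken at the point before [i] switches. *)
  rewrite -opprB (multilinear_diff (i := i) fE) => [|j ji]; last first.
    rewrite !mxE !inE ltn_neqAle; suff -> : (p j : nat) != p i by [].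
    by rewrite (inj_eq val_inj) (inj_eq perm_inj).
  by rewrite !mxE !inE ltnn leqnn -mulNr opprB.
rewrite /shapley_shubik (eq_bigr _ (fun p _ => stepE p)) -mulr_sumr mulrCA; congr (_ * _).
rewrite (partition_big (fun p : 'S_n => predecessors p i) (fun S => i \notin S)) /=; last first.
  by move=> p _; rewrite notin_predecessors.
transitivity (\sum_(S : {set 'I_n} | i \notin S)
    poly_int ('X^#|S| * (1 - 'X) ^+ (n.-1 - #|S|) : {poly R}) * G S).
  rewrite mulr_sumr; apply: eq_bigr => S iS.
  rewrite (eq_bigr (fun=> G S)) => [|p /eqP-> //]; rewrite sumr_const.
  have -> : #|[pred p : 'S_n | predecessors p i == S]| = predecessor_count i S.
    by apply: eq_card => p; rewrite !inE.
  have Sn : (#|S| <= n.-1)%N.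
    rewrite -ltnS prednK // -[X in (_ < X)%N]card_ord -[X in (_ < X)%N]cardsT.
    by apply: proper_card; rewrite properT; apply: contraNneq iS => ->; rewrite inE.
  rewrite predecessor_countE // poly_int_beta subnKC // prednK //.
  by rewrite -[G S *+ _]mulr_natl mulrA [_^-1 * _]mulrC.
under [RHS]eq_bigr do rewrite /path_poly prod_affine_bernstein poly_int_sum mulr_sumr.
rewrite exchange_big /=; apply: eq_bigr => S iS; rewrite /G /mpartial mulr_sumr.
apply: eq_bigr => A _; rewrite poly_intZ mulrCA; congr (_ * _).
by rewrite mulrC; congr (_ * _); apply: eq_bigr => j _; rewrite mxE.
Qed.
End Attributions.

(** * The program *)

Definition for_loop (x : nat) (e : iexpr) (p : cmd) : cmd :=
  Seq (SetVar x (ILit 0))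
    (While (TNot (TLe e (IVar x))) (Seq p (SetVar x (IAdd (IVar x) (ILit 1))))).

(** * Program logic with time budgets *)

Section Runs.
Context {R : realType} {n : nat}.
Variables (terms : seq ({set 'I_n} * R)) (i : 'I_n) (M : nat).

(** Total correctness with an upper bound on the time, so that budgets add along the syntax and may
    be loose. *)
Definition runs (p : cmd) (st : state R) (T : nat) (Q : state R -> Prop) : Prop :=
  exists st' t, [/\ exec terms i M p st st' t, (t <= T)%N & Q st'].

Lemma runs_weaken p st T T' (Q Q' : state R -> Prop) :
  (T <= T')%N -> (forall st', Q st' -> Q' st') ->
  runs p st T Q -> runs p st T' Q'.
Proof.
move=> leT QQ' [st' [t [ex le Qst]]]; exists st', t; split=> //.
- exact: leq_trans leT.
- exact: QQ'.
Qed.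

Lemma runs_skip st T (Q : state R -> Prop) : Q st -> runs Skip st T Q.
Proof. by move=> Qst; exists st, 0%N; split=> //; constructor. Qed.

Lemma runs_seq p q st T1 T2 (Q : state R -> Prop) :
  runs p st T1 (fun st1 => runs q st1 T2 Q) -> runs (Seq p q) st (T1 + T2) Q.
Proof.
move=> [st1 [t1 [e1 l1 [st2 [t2 [e2 l2 Qst]]]]]].
by exists st2, (t1 + t2)%N; split; [exact: ExecSeq e1 e2|exact: leq_add|].
Qed.

Lemma runs_if b p q st T (Q : state R -> Prop) :
  (teval terms i (ivar st) b -> runs p st T Q) ->
  (~~ teval terms i (ivar st) b -> runs q st T Q) -> runs (If b p q) st T Q.
Proof.
case: (boolP (teval terms i (ivar st) b)) => hb.
- move=> /(_ isT) [st' [t [ex le Qst]]] _; exists st', t; split=> //.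
  exact: ExecIfTrue.
- move=> _ /(_ isT) [st' [t [ex le Qst]]]; exists st', t; split=> //.
  exact: ExecIfFalse.
Qed.

Lemma runs_set_var x e st T (Q : state R -> Prop) :
  Q (set_ivar st x (ieval terms i (ivar st) e)) -> runs (SetVar x e) st T Q.
Proof. by move=> Qst; eexists _, 0%N; split; [by constructor| |exact: Qst]. Qed.

Lemma runs_load_lit a m st T (Q : state R -> Prop) :
  let a' := ieval terms i (ivar st) a in
  (a' < M)%N -> Q (set_cell st a' m%:~R) -> runs (LoadLit a m) st T Q.
Proof. by move=> a' lt Qst; eexists _, 0%N; split; [by constructor| |exact: Qst]. Qed.

Lemma runs_load_coef a k st T (Q : state R -> Prop) :
  let a' := ieval terms i (ivar st) a in
  let k' := ieval terms i (ivar st) k in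
  (a' < M)%N -> (k' < size terms)%N ->
  Q (set_cell st a' (term_at terms k').2) -> runs (LoadCoef a k) st T Q.
Proof.
by move=> a' k' lta ltk Qst; eexists _, 0%N; split; [by constructor| |exact: Qst].
Qed.

Lemma runs_move a b st T (Q : state R -> Prop) :
  let a' := ieval terms i (ivar st) a in
  let b' := ieval terms i (ivar st) b in
  (a' < M)%N -> (b' < M)%N ->
  Q (set_cell st a' (cell st b')) -> runs (Move a b) st T Q.
Proof.
by move=> a' b' lta ltb Qst; eexists _, 0%N; split; [by constructor| |exact: Qst].
Qed.

Lemma runs_arith o a b d st T (Q : state R -> Prop) :
  let a' := ieval terms i (ivar st) a in
  let b' := ieval terms i (ivar st) b in
  let d' := ieval terms i (ivar st) d in
  (a' < M)%N -> (b' < M)%N -> (d' < M)%N ->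
  (o = OpDiv -> cell st d' != 0) ->
  Q (set_cell st a' (aeval o (cell st b') (cell st d'))) ->
  runs (Arith o a b d) st T.+1 Q.
Proof.
by move=> a' b' d' lta ltb ltd nz Qst; eexists _, 1%N; split;
  [by constructor| |exact: Qst].
Qed.

(** Only the body costs time, since control is free. The bound [e] must have the same value in all
    states, and the body must leave the counter as it found it. *)
Lemma runs_for (Inv : nat -> state R -> Prop) x e p m T st (Q : state R -> Prop) :
  (forall v, ieval terms i v e = m) ->
  Inv 0%N (set_ivar st x 0) ->
  (forall k st, (k < m)%N -> ivar st x = k -> Inv k st ->
     runs p st T (fun st' => ivar st' x = k /\ Inv k.+1 (set_ivar st' x k.+1))) ->
  (forall st, Inv m st -> Q st) ->
  runs (for_loop x e p) st (m * T) Q.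
Proof.
move=> he I0 step fin; rewrite /for_loop -[(m * T)%N]add0n; apply: runs_seq.
apply: runs_set_var => /=.
(* Induction on the number [d] of remaining rounds. *)
have main d k st0 : (k + d)%N = m -> ivar st0 x = k -> Inv k st0 ->
    runs (While (TNot (TLe e (IVar x))) (Seq p (SetVar x (IAdd (IVar x) (ILit 1)))))
      st0 (d * T) Q.
  elim: d k st0 => [|d IH] k st0 km xk Ik.
    exists st0, 0%N; split=> //.
    - by apply: ExecWhileFalse; rewrite /= negbK he xk; lia.
    - by apply: fin; rewrite -km addn0.
  have km' : (k < m)%N by lia.
  have [st1 [t1 [e1 l1 [x1 I1]]]] := step k st0 km' xk Ik.
  have kd : (k.+1 + d)%N = m by lia.
  have xk1 : ivar (set_ivar st1 x k.+1) x = k.+1 by rewrite /= eqxx.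
  have [st2 [t2 [e2 l2 Q2]]] := IH _ _ kd xk1 I1.
  exists st2, (t1 + 0 + t2)%N; split=> //; last by rewrite mulSn; lia.
  apply: ExecWhileTrue e2; first by rewrite /= he xk; lia.
  apply: ExecSeq e1 _.
  have -> : k.+1 = ieval terms i (ivar st1) (IAdd (IVar x) (ILit 1)).
    by rewrite /= x1 addn1.
  exact: ExecSetVar.
by apply: (main m 0%N) => //=; rewrite eqxx.
Qed.

End Runs.

(* Beyond r and s the memory holds an accumulator at 2n, four scratch cells, and
   at 2n+5+k, for k <= n, the coefficient of X^(n-k) in X times the current
   product.  With the degrees reversed and the zero coefficient of X^0 stored
   too, an ascending sweep multiplies by an affine factor in place. *)
Definition acc_cell := IAdd INvars INvars.
Definition scratch (k : nat) := IAdd acc_cell (ILit k.+1).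
Definition divisor_cell := scratch 0.
Definition tmp_cell := scratch 1.
Definition slope_cell := scratch 2.
Definition one_cell := scratch 3.
Definition poly_cell (k : iexpr) := IAdd (scratch 4) k.

Definition term_var := IVar 0.
Definition factor_var := IVar 1.
Definition index_var := IVar 2.
Definition succ_index := IAdd index_var (ILit 1).

(** Cells j and n + j hold r_j and s_j, so the counter itself serves as an address. The coefficient
    of next lower degree lies one cell ahead and is read before it is overwritten. *)
Definition multiply_by_factor : cmd :=
  Seq (Arith OpSub slope_cell (IAdd INvars factor_var) factor_var)
    (for_loop 2 INvars
       (Seq (Arith OpMul tmp_cell slope_cell (poly_cell succ_index))
       (Seq (Arith OpMul (poly_cell index_var) factor_var (poly_cell index_var))
            (Arith OpAdd (poly_cell index_var) (poly_cell index_var) tmp_cell)))).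

(** The factor s_i - r_i is absorbed into the starting coefficient. X has index n - 1 in the
    reversed storage. *)
Definition start_poly : cmd :=
  Seq (for_loop 2 (IAdd INvars (ILit 1)) (LoadLit (poly_cell index_var) 0))
  (Seq (LoadCoef tmp_cell term_var)
  (Seq (Arith OpSub slope_cell (IAdd INvars ITarget) ITarget)
       (Arith OpMul (poly_cell (ISub INvars (ILit 1))) tmp_cell slope_cell))).

(** The real divisor is built by repeatedly adding 1, because naturals cannot be converted to
    reals. *)
Definition integrate_poly : cmd :=
  Seq (LoadLit divisor_cell 0)
    (for_loop 2 INvars
       (Seq (Arith OpAdd divisor_cell divisor_cell one_cell)
       (Seq (Arith OpDiv tmp_cell (poly_cell (ISub INvars succ_index)) divisor_cell)
            (Arith OpAdd acc_cell acc_cell tmp_cell)))).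

Definition add_term : cmd :=
  Seq start_poly
  (Seq (for_loop 1 INvars
          (If (TAnd (TOccurs term_var factor_var)
                    (TNot (TAnd (TLe factor_var ITarget) (TLe ITarget factor_var))))
              multiply_by_factor Skip))
       integrate_poly).

(** Cell 0 holds r_0 during the computation, so the result is moved there only at the end. *)
Definition ass_program : cmd :=
  Seq (LoadLit acc_cell 0)
  (Seq (LoadLit one_cell 1)
  (Seq (for_loop 0 INterms (If (TOccurs term_var ITarget) add_term Skip))
       (Move (ILit 0) acc_cell))).

(** * Correctness and cost of the program *)

Section Program.
Context {R : realType} {n : nat}.
Variables (terms : seq ({set 'I_n} * R)) (i : 'I_n) (M : nat) (r s : 'rV[R]_n).
(** The highest address in use is 2n + 5 + n, that of the constant coefficient. *)
Hypothesis leM : (3 * n + 6 <= M)%N.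

Definition memory_ok (a : R) (st : state R) : Prop :=
  [/\ initial r s st, cell st (n + n) = a & cell st (n + n + 4) = 1].

Definition holds_poly (q : {poly R}) (st : state R) : Prop :=
  forall k, (k <= n)%N -> cell st (n + n + 5 + k) = q`_(n - k).

Lemma memory_ok_set_cell a st b y :
  (n + n < b)%N -> b <> (n + n + 4)%N -> memory_ok a st -> memory_ok a (set_cell st b y).
Proof.
move=> lb nb [rs acc one]; split=> [p|/=|/=].
- by have [rp sp] := rs p; have pn := ltn_ord p; split; rewrite /= ifF ?rp ?sp //; lia.
- by rewrite ifF //; lia.
- by rewrite ifF //; lia.
Qed.

Ltac cells := rewrite /=; repeat (case: (@eqP nat _ _) => [?|?]; try (exfalso; lia)).

(** One subtraction for the slope, then three operations per coefficient. The sweep leaves the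
    constant coefficient alone, which is right because it is 0 before and after. *)
Lemma multiply_by_factor_runs (j : 'I_n) a q st k :
  ivar st 0 = k -> ivar st 1 = j -> memory_ok a st -> holds_poly q st -> q`_0 = 0 ->
  runs terms i M multiply_by_factor st (1 + n * 3) (fun st' =>
    [/\ ivar st' 0 = k, ivar st' 1 = j, memory_ok a st' &
      holds_poly (q * ((r ord0 j)%:P + (s ord0 j - r ord0 j) *: 'X)) st']).
Proof.
move=> v0 v1 ok hq q0.
have jn := ltn_ord j.
have [rs _ _] := ok; have [rj sj] := rs j.
apply: runs_seq; apply: runs_arith => //=; rewrite ?v1; try lia.
pose q' := q * ((r ord0 j)%:P + (s ord0 j - r ord0 j) *: 'X).
have q'S l : q'`_l.+1 = r ord0 j * q`_l.+1 + (s ord0 j - r ord0 j) * q`_l.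
  by rewrite /q' mulrDr coefD coefMC mulrC -scalerAr coefZ coefMX.
have q'0 : q'`_0 = 0.
  by rewrite /q' mulrDr coefD coefMC q0 -scalerAr coefZ coefMX /= mul0r mulr0 addr0.
(* After [m] rounds the first [m] cells hold the new coefficients and the others the old ones. *)
apply: (runs_for (m := n) (Inv := fun m st' =>
  [/\ ivar st' 0 = k, ivar st' 1 = j, memory_ok a st',
      cell st' (n + n + 3) = s ord0 j - r ord0 j &
      forall l, (l <= n)%N ->
        cell st' (n + n + 5 + l) = if (l < m)%N then q'`_(n - l) else q`_(n - l)])) => //=.
- split=> //=.
  + by apply: memory_ok_set_cell ok; lia.
  + by rewrite eqxx rj sj.
  + by move=> l ln; cells; rewrite hq.
- move=> m st1 mn v2 [w0 w1 ok1 slope1 hq1].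
  have [rs1 _ _] := ok1; have [rj1 _] := rs1 j.
  apply: (runs_seq (T1 := 1) (T2 := 2)); apply: runs_arith => //=; rewrite ?w1 ?v2; try lia.
  apply: (runs_seq (T1 := 1) (T2 := 1)); apply: runs_arith => //=; rewrite ?w1 ?v2; try lia.
  apply: runs_arith => //=; rewrite ?v2; try lia.
  split=> //; split=> //.
  + by do 3 (apply: memory_ok_set_cell; [lia|lia|]).
  + by cells.
  + move=> l ln; case: (ltngtP l m) => lm.
    * by cells; rewrite hq1 // lm ifT //; lia.
    * by cells; rewrite hq1 // !ifF //; lia.
    * rewrite {l}lm in ln *; cells.
      rewrite slope1 rj1 ltnSn !hq1 //; last lia.
      have -> : (m + 1 < m)%N = false by lia.
      rewrite ltnn.
      have -> : (n - m = (n - (m + 1)).+1)%N by lia.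
      by rewrite q'S.
- move=> st1 [w0 w1 ok1 _ hq1]; split=> // l ln; rewrite hq1 //.
  case: ltnP => // nl; have -> : (n - l = 0)%N by lia.
  by rewrite q0 q'0.
Qed.

Lemma start_poly_runs a st k :
  (k < size terms)%N -> ivar st 0 = k -> memory_ok a st ->
  runs terms i M start_poly st 2 (fun st' =>
    [/\ ivar st' 0 = k, memory_ok a st' &
      holds_poly (((term_at terms k).2 * (s ord0 i - r ord0 i)) *: 'X) st']).
Proof.
move=> kN v0 ok; have n_gt0 := ltn_ord i.
(* Loading literals is free, so clearing n + 1 cells has budget (n + 1) * 0. *)
apply: (runs_seq (T1 := 0) (T2 := 2)); rewrite -[X in runs _ _ _ _ _ X](muln0 (n + 1)).
apply: (runs_for (m := (n + 1)%N) (Inv := fun m st' =>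
  [/\ ivar st' 0 = k, memory_ok a st' &
    forall l, (l < m)%N -> cell st' (n + n + 5 + l) = 0])) => //=.
- move=> m st1 mn v2 [w0 ok1 z1].
  apply: runs_load_lit => /=; rewrite v2; first lia.
  split=> //; split=> //; first by apply: memory_ok_set_cell; [lia|lia|].
  by move=> l lm; cells=> //; rewrite z1 //; lia.
move=> {v0 ok}st1 [v0 ok z1]; have [rs _ _] := ok; have [ri si] := rs i.
apply: (runs_seq (T1 := 0) (T2 := 2)); apply: runs_load_coef => /=; rewrite ?v0 //; first lia.
apply: (runs_seq (T1 := 1) (T2 := 1)); apply: runs_arith => //=; try lia.
apply: runs_arith => //=; try lia.
split=> //; first by do 3 (apply: memory_ok_set_cell; [lia|lia|]).
move=> l ln; rewrite coefZ coefX; cells.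
- by rewrite ri si mulr1.
- by rewrite mulr0 z1 //; lia.
Qed.

(** Since X * p is stored, the coefficient of degree m of [p] is in cell n - (m + 1) of the block;
    the size bound makes n rounds enough. *)
Lemma integrate_poly_runs a (p : {poly R}) st k :
  (size p <= n)%N -> ivar st 0 = k -> memory_ok a st -> holds_poly ('X * p) st ->
  runs terms i M integrate_poly st (n * 3) (fun st' =>
    ivar st' 0 = k /\ memory_ok (a + poly_int p) st').
Proof.
move=> sp v0 ok hp; have n_gt0 := ltn_ord i.
apply: (runs_seq (T1 := 0)); apply: runs_load_lit => /=; first lia.
apply: (runs_for (m := n) (Inv := fun m st' =>
  [/\ ivar st' 0 = k, memory_ok (a + \sum_(l < m) p`_l / l.+1%:R) st',
    cell st' (n + n + 1) = m%:R & holds_poly ('X * p) st'])) => //=.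
- split=> //=.
  + by rewrite big_ord0 addr0; apply: memory_ok_set_cell ok; lia.
  + by rewrite eqxx.
  + by move=> l ln; cells; rewrite hp.
- move=> m st1 mn v2 [w0 [rs acc one] dv hp1].
  apply: (runs_seq (T1 := 1) (T2 := 2)); apply: runs_arith => //=; try lia.
  apply: (runs_seq (T1 := 1) (T2 := 1)); apply: runs_arith => //=; rewrite ?v2; try lia.
    by move=> _; cells; rewrite dv one natr1 pnatr_eq0.
  apply: runs_arith => //=; try lia.
  split=> //; split=> //.
  + split=> [l|/=|/=].
    * by have ln := ltn_ord l; have [rl sl] := rs l; split; cells.
    * cells; rewrite acc dv one natr1 hp1; last by lia.
      have -> : (n - (n - (m + 1)) = m.+1)%N by lia.
      by rewrite coefXM /= big_ord_recr /= addrA.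
    * by cells.
  + by cells; rewrite dv one natr1.
  + by move=> l ln; cells; rewrite hp1.
- move=> st1 [w0 ok1 _ _]; by split=> //; rewrite (poly_int_widen sp).
Qed.

Lemma add_term_runs a st k :
  (k < size terms)%N -> ivar st 0 = k -> memory_ok a st ->
  runs terms i M add_term st (11 * n ^ 2) (fun st' =>
    ivar st' 0 = k /\
    memory_ok (a + (s ord0 i - r ord0 i) *
      ((term_at terms k).2 * poly_int (path_poly r s i (term_at terms k).1))) st').
Proof.
move=> kN v0 ok; have n_gt0 : (0 < n)%N by exact: leq_trans (ltn_ord i).
set A := (term_at terms k).1; set e := (term_at terms k).2 * (s ord0 i - r ord0 i).
(* The partial product after the first [m] players have been examined. *)
pose q m : {poly R} := \prod_(j < n | [&& (j < m)%N, j \in A & j != i])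
  ((r ord0 j)%:P + (s ord0 j - r ord0 j) *: 'X).
(* The exact budget 3n^2 + 4n + 2 is at most 9n^2 because n >= 1; the constant 11 leaves slack. *)
apply: (@runs_weaken _ _ _ _ _ _ _ (2 + (n * (1 + n * 3) + n * 3))); first by rewrite -mulnn; nia.
  by move=> st'; exact: id.
apply: runs_seq; apply: runs_weaken (start_poly_runs kN v0 ok) => // st1 [v1 ok1 h1].
apply: runs_seq; apply: (runs_for (m := n) (Inv := fun m st' =>
  [/\ ivar st' 0 = k, memory_ok a st' & holds_poly ('X * (e *: q m)) st'])) => //=.
- split=> //; suff -> : q 0%N = 1 by rewrite -scalerAr mulr1.
  by rewrite /q big1 // => j.
- move=> m st2 mn v2 [w0 ok2 h2].
  pose j := Ordinal mn.
  have qS : q m.+1 = q m * (if (j \in A) && (j != i)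
      then (r ord0 j)%:P + (s ord0 j - r ord0 j) *: 'X else 1).
    rewrite /q; case: ifP => [jAi|/negbT jAi].
      rewrite (bigD1 j) /= ?ltnSn // mulrC; congr (_ * _); apply: eq_bigl => l.
      have -> : (l != j) = ((l : nat) != m) by [].
      by rewrite ltnS; case: ltngtP => //=; rewrite ?andbF ?andbT.
    rewrite mulr1; apply: eq_bigl => l; rewrite ltnS leq_eqVlt.
    case: (altP ((l : nat) =P m)) => //= lm; have -> : l = j by exact: val_inj.
    by rewrite (negbTE jAi) ltnn.
  have testE : teval terms i (ivar st2) (TAnd (TOccurs term_var factor_var)
      (TNot (TAnd (TLe factor_var ITarget) (TLe ITarget factor_var)))) = (j \in A) && (j != i).
    rewrite /= w0 v2 -eqn_leq -/A; congr (_ && _).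
    apply/existsP/idP => [[l /andP[lA /eqP lm]]|jA]; last by exists j; rewrite jA /=.
    by rewrite (_ : j = l) //; exact: val_inj.
  apply: runs_if; rewrite testE => jAi.
  + apply: runs_weaken (multiply_by_factor_runs (j := j) w0 v2 ok2 h2 _) => //.
      by move=> st3 [? ? ? ?]; split=> //; split=> //; rewrite qS jAi scalerAl mulrA.
    by rewrite coefXM.
  + by apply: runs_skip; split=> //; split=> //; rewrite qS (negbTE jAi) mulr1.
- move=> st2 [w0 ok2 h2].
  have qE : q n = path_poly r s i A.
    by apply: eq_bigl => j; rewrite ltn_ord.
  rewrite qE in h2.
  apply: runs_weaken (integrate_poly_runs _ w0 ok2 h2) => //.
    by move=> st3 [? ?]; rewrite [_ * (_ * _)]mulrCA mulrA -poly_intZ.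
  (* Player [i] is excluded, so there are at most n - 1 factors and at most n coefficients. *)
  apply: leq_trans (size_scale_leq _ _) _.
  apply: leq_trans (size_prod_affine _ _ _ _) _.
  rewrite -sum1_count sum1_card.
  have : (#|[pred j | (j \in A) && (j != i)]| <= #|predC1 i|)%N.
    by apply: subset_leq_card; apply/fintype.subsetP => j; rewrite !inE => /andP[].
  by rewrite cardC1 card_ord -ltnS prednK.
Qed.

Lemma ass_program_runs st :
  initial r s st ->
  runs terms i M ass_program st (size terms * (11 * n ^ 2)) (fun st' =>
    cell st' 0 = \sum_(u <- terms | i \in u.1)
      (s ord0 i - r ord0 i) * (u.2 * poly_int (path_poly r s i u.1))).
Proof.
move=> rs; have n_gt0 : (0 < n)%N by exact: leq_trans (ltn_ord i).
apply: (runs_seq (T1 := 0)); apply: runs_load_lit => /=; first lia.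
apply: (runs_seq (T1 := 0)); apply: runs_load_lit => /=; first lia.
rewrite -[X in runs _ _ _ _ _ X]addn0; apply: runs_seq.
pose g k := if i \in (term_at terms k).1 then (s ord0 i - r ord0 i) *
  ((term_at terms k).2 * poly_int (path_poly r s i (term_at terms k).1)) else 0.
apply: (runs_for (m := size terms) (Inv := fun m => memory_ok (\sum_(k < m) g k))) => //=.
- rewrite big_ord0; split=> [j|/=|/=].
  + by have [rj sj] := rs j; have jn := ltn_ord j; split; cells.
  + by cells.
  + by cells.
- move=> k st1 kN v1 ok.
  have testE : teval terms i (ivar st1) (TOccurs term_var ITarget) = (i \in (term_at terms k).1).
    rewrite /= v1; apply/existsP/idP => [[l /andP[lA /eqP lm]]|iA]; last by exists i; rewrite iA /=.
    by rewrite (_ : i = l) //; exact: val_inj.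
  rewrite big_ord_recr /= /g; apply: runs_if; rewrite testE => iA.
  + apply: runs_weaken (add_term_runs kN v1 ok) => // st2 [v2 ok2].
    by split=> //; rewrite iA.
  + by apply: runs_skip; split=> //; rewrite (negbTE iA) addr0.
- move=> st1 [_ acc _]; apply: runs_move => /=; [lia|lia|].
  rewrite acc (big_nth (finset.set0, 0)) big_mkord [RHS]big_mkcond /=.
  by apply: eq_bigr.
Qed.

End Program.

(** * From the input list to the closed form *)

Section InputTerms.
Context {R : realType} {n : nat}.
Implicit Types (c : {set 'I_n} -> R) (terms : seq ({set 'I_n} * R)).

Lemma size_nonzero_terms c : size (nonzero_terms c) = #|[set A | c A != 0]%SET|.
Proof.
rewrite size_map size_filter -sum1_count -sum1_card big_enum_cond /=.
by apply: eq_bigl => A; rewrite inE.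
Qed.

(** A sum ignores the order of the list, and the sets missing from it have coefficient 0. *)
Lemma attribution_terms c terms (r s : 'rV[R]_n) (i : 'I_n) :
  perm_eq terms (nonzero_terms c) ->
  attribution c r s i = \sum_(u <- terms | i \in u.1)
    (s ord0 i - r ord0 i) * (u.2 * poly_int (path_poly r s i u.1)).
Proof.
move=> pe; rewrite (perm_big _ pe) big_map big_filter_cond big_enum_cond /=.
rewrite /attribution mulr_sumr [LHS]big_mkcond [RHS]big_mkcond; apply: eq_bigr => A _.
by have [->|] := eqVneq (c A) 0; rewrite //= mul0r mulr0 if_same.
Qed.

End InputTerms.

Theorem corollary4p6 (R : realType) :
  exists (prog : cmd) (C D : nat),
  forall (n N : nat) (c : {set 'I_n} -> R) (f : 'rV[R]_n -> R)
    (terms : seq ({set 'I_n} * R)),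
  multilinear_with c f ->
  #|[set A : {set 'I_n} | c A != 0]%SET| = N ->
  perm_eq terms (nonzero_terms c) ->
  forall (r s : 'rV[R]_n) (i : 'I_n),
  exists z : R,
    aumann_shapley_shubik r s f i z /\
    computes_within prog terms r s i z (C * (n ^ 2 * N)) (D * n).
Proof.
(* 11 is the cost constant of one monomial; 9 comes from 3n + 6 <= 9n, valid since a player [i]
   exists and hence n >= 1. *)
exists ass_program, 11%N, 9%N => n N c f terms fE cN pe r s i.
have n_gt0 : (0 < n)%N by exact: leq_trans (ltn_ord i).
exists (attribution c r s i); split.
  by split; [rewrite (aumann_shapleyE _ _ _ fE)|rewrite (shapley_shubikE _ _ _ fE)].
split; first lia.
move=> st rs; have leM : (3 * n + 6 <= 9 * n)%N by lia.
have [st' [t [ex le e]]] := ass_program_runs terms i leM rs.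
exists st', t; split=> //; last by rewrite (attribution_terms _ _ _ pe).
by rewrite -cN -size_nonzero_terms -(perm_size pe) mulnA mulnC.
Qed.
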